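(* Let $X$ be a metrizable space. Then the space $Q_p(X,\mathbb{R})$ is Fréchet-Urysohn if and only if $X$ is countable.
   Context: ''Countable'' means finite or countably infinite. The statement is a theorem of ZFC (no additional set-theoretic assumptions). A function $f:X\to\mathbb{R}$ on a topological space $X$ is quasicontinuous if for every $x\in X$ and all open sets $U\ni x$ in $X$ and $V\ni f(x)$ in $\mathbb{R}$ there is a nonempty open set $W\subseteq U$ with $f(W)\subseteq V$. $Q_p(X,\mathbb{R})$ denotes the set of all quasicontinuous functions $X\to\mathbb{R}$ with the topology of pointwise convergence (the subspace topology from the product $\mathbb{R}^X$). A space $Y$ is Fréchet-Urysohn if for every $A\subseteq Y$ and every $y\in\overline{A}$ there is a sequence in $A$ converging to $y$. *)

(* Defs.v *)
From mathcomp Require Import all_boot all_order all_algebra.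
From mathcomp Require Import all_classical all_reals all_analysis.

Set Implicit Arguments.
Unset Strict Implicit.
Unset Printing Implicit Defensive.

Import Order.TTheory GRing.Theory Num.Theory.
Import numFieldNormedType.Exports.

Local Open Scope classical_set_scope.
Local Open Scope ring_scope.

Definition is_metric (R : realType) (T : Type) (d : T -> T -> R) : Prop :=
  [/\ forall x y, 0 <= d x y,
      forall x y, d x y = 0 <-> x = y,
      forall x y, d x y = d y x &
      forall x y z, d x z <= d x y + d y z].

Definition metrizable (R : realType) (X : topologicalType) : Prop :=
  exists2 d : X -> X -> R, is_metric d &
    forall U : set X, open U <->
      forall x, U x -> exists2 e : R, 0 < e & [set y | d x y < e] `<=` U.

Definition quasicontinuous (X Y : topologicalType) (f : X -> Y) : Prop :=
  forall (x : X) (U : set X) (V : set Y),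
    open U -> U x -> open V -> V (f x) ->
    exists W : set X, [/\ open W, W !=set0, W `<=` U & f @` W `<=` V].

(* Coerced to a type, a set carries the initial topology for its inclusion
   ([set_type], from subtype_topology), here into the product [{ptws X -> Y}].
   This is not the library's [subspace A], which keeps all the points of the
   ambient space and isolates those outside [A]. *)
Definition Qp (X Y : topologicalType) : set {ptws X -> Y} :=
  [set f | quasicontinuous f].
Arguments Qp : clear implicits.

Definition frechet_urysohn (Y : topologicalType) : Prop :=
  forall (A : set Y) (y : Y), closure A y ->
    exists2 u : nat -> Y, (forall n, A (u n)) & u @ \oo --> y.

(* Main.v *)
(* For [C] regular closed, every two-valued function that is constant on [C]
   and on its complement is quasicontinuous.  Applied to such functions, the
   Frechet-Urysohn property selects, from families of regular closed sets in
   which every finite set is contained in a member, a sequence that eventually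
   contains each point.  If every point [b] lies in a regular closed set meeting
   [F] at most at [b] (as happens for closed nowhere dense sets and for uniformly
   isolated sets), this makes [F] countable.  So the set [I] of isolated points
   is countable.  Selecting next from regular closed sets [C] whose complements
   come within [1/(n+1)] of every point outside [I], with [n] tending to
   infinity, covers [~` I] by the closed nowhere dense sets obtained by
   intersecting the tails of the sequence; these are countable as well.  This
   rules out the Luzin-type spaces, all of whose nowhere dense sets are
   countable. *)

Require Import Defs.
From mathcomp Require Import all_boot all_order all_algebra.
From mathcomp Require Import all_classical all_reals all_analysis.
Import numFieldNormedType.Exports.
Import Order.TTheory GRing.Theory Num.Theory.
Local Open Scope classical_set_scope.
Local Open Scope ring_scope.
Set Implicit Arguments.
Unset Strict Implicit.
Unset Printing Implicit Defensive.

(** * Pointwise convergence in [Qp X R] and the countable case *)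

Lemma subtype_cvgE (T : topologicalType) (A : set T) (F : set_system A) (y : A) :
  Filter F -> F --> y <-> set_val @ F --> (set_val y : T).
Proof.
move=> FF; split=> [Fy|Fy].
  exact: cvg_comp Fy (@initial_continuous _ _ (@set_val T A) y).
move=> U [/= _ [[W oW <-] /= Wy] WU].
by apply: filterS WU _; apply: Fy; exact: open_nbhs_nbhs.
Qed.

Lemma Qp_cvgP (R : realType) (X : topologicalType) (F : set_system (Qp X R))
    (f : Qp X R) : Filter F ->
  F --> f <-> forall x, (fun g : Qp X R => set_val g x) @ F --> set_val f x.
Proof.
move=> FF; rewrite subtype_cvgE.
exact: (@pointwise_cvgP X R (set_val @ F) (set_val f)).
Qed.

(** For the converse, the sets of functions [e]-close to [f] on a finite list form a filter base;
    its filter converges to [f] pointwise, so every neighbourhood of [f] contains one of these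
    sets. *)
Lemma Qp_closureP (R : realType) (X : topologicalType) (A : set (Qp X R))
    (f : Qp X R) : closure A f <->
  forall (s : seq X) (e : R), 0 < e ->
    exists2 g, A g & forall x, x \in s -> `|set_val f x - set_val g x| < e.
Proof.
split=> [clf s e e0|Af U Uf].
- have fE := (Qp_cvgP f (nbhs_filter f)).1 (@cvg_id _ (nbhs f)).
  suff /clf[g [Ag gs]] : nbhs f [set g : Qp X R | forall x, x \in s ->
      `|set_val f x - set_val g x| < e] by exists g.
  elim: s => [|a s IHs]; first by apply: (@filterE _ _ (nbhs_filter f)).
  have /cvgr_dist_lt/(_ _ e0) fa := fE a.
  apply: (@filterS2 _ _ (nbhs_filter f) _ _ _ _ fa IHs) => g ga gs x.
  by rewrite inE => /predU1P[->|/gs].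
- pose B (p : seq X * R) : set (Qp X R) :=
    [set g | forall x, x \in p.1 -> `|set_val f x - set_val g x| < p.2].
  pose G := filter_from [set p : seq X * R | 0 < p.2] B.
  have GF : Filter G.
    apply: filter_from_filter => [|[s e] [t d] /= e0 d0].
      by exists ([::], 1); exact: ltr01.
    exists (s ++ t, Num.min e d); first by rewrite /= lt_min e0.
    move=> g gst; split=> x xs.
      by have := gst x; rewrite /= mem_cat xs lt_min => /(_ isT)/andP[].
    by have := gst x; rewrite /= mem_cat xs orbT lt_min => /(_ isT)/andP[].
  have Gf : G --> f.
    apply/Qp_cvgP => x; apply/cvgrPdist_lt => e e0.
    by exists ([:: x], e) => //= g; apply; rewrite inE.
  have [[s e] /= e0 BU] := Gf _ Uf.
  by have [g Ag gs] := Af s e e0; exists g; split => //; exact: BU.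
Unshelve. all: by end_near. Qed.

(** An injection into [nat] leaves finitely many points of code at most [n]; the [n]-th term
    approximates [f] within [1/(n+1)] on these. *)
Lemma countable_frechet_urysohn (R : realType) (X : topologicalType) :
  countable [set: X] -> frechet_urysohn (Qp X R).
Proof.
move=> /countable_injP[e einj] A f /Qp_closureP Af.
have fin n : exists s : seq X, forall x, (e x <= n)%N -> x \in s.
  have : finite_set (e @^-1` `I_n.+1).
    apply: finite_preimage; last exact: finite_II.
    by move=> x y _ _; apply: einj; rewrite inE.
  by move=> /finite_seqP[s sE]; exists s => x xn; have : [set` s] x by rewrite -sE.
have /choice[u uP] n : exists g, A g /\ forall x, (e x <= n)%N ->
    `|set_val f x - set_val g x| < n.+1%:R^-1 :> R.
  have [s sP] := fin n.
  have [|g Ag gs] := Af s n.+1%:R^-1; first by rewrite invr_gt0.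
  by exists g; split => // x /sP; exact: gs.
exists u => [n|]; first by case: (uP n).
apply/Qp_cvgP => x; apply/cvgrPdist_lt => r r0 /=.
suff: \forall n \near \oo, `|set_val f x - set_val (u n) x| < r by [].
near=> n; apply: (@lt_trans _ _ n.+1%:R^-1).
  by apply: (uP n).2; near: n; exact: nbhs_infty_ge.
by near: n; exact: (near_infty_natSinv_lt (PosNum r0)).
Unshelve. all: by end_near. Qed.

(** * Selecting a sequence of regular closed sets *)

Lemma quasicontinuous_regclosed (X Y : topologicalType) (C : set X) (a b : Y) :
  regclosed C -> quasicontinuous (fun x => if x \in C then a else b).
Proof.
move=> rC x U V oU Ux oV; case: ifPn => [/set_mem Cx Va|/negP xC Vb].
(* A point of [C] is in the closure of the interior of [C], so that interior meets [U]; off [C], the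
   open complement serves. *)
- move: Cx; rewrite -[X in X x]rC => /(_ U (open_nbhs_nbhs (conj oU Ux))).
  move=> [z [Cz Uz]]; exists (C° `&` U); split.
  + by apply: openI => //; exact: open_interior.
  + by exists z.
  + by move=> ? [].
  + by move=> _ [t [/interior_subset Ct _] <-]; rewrite mem_set.
- exists (~` C `&` U); split.
  + apply: openI => //; rewrite openC -[C]rC; exact: closed_closure.
  + by exists x; split => //= Cx; apply: xC; exact: mem_set.
  + by move=> ? [].
  + by move=> _ [t [Ct _] <-]; rewrite memNset.
Qed.

(* The functions [1/(n+1) + 1_(~` C)] with [C] in [CC n] accumulate at [0];
   convergence of such a sequence to [0] forces both [n] to tend to infinity
   and every point to lie in [C] eventually. *)
Lemma frechet_urysohn_selection (R : realType) (X : topologicalType)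
    (CC : nat -> set (set X)) :
  frechet_urysohn (Qp X R) ->
  (forall n C, CC n C -> regclosed C) ->
  (forall n (s : seq X), exists2 C, CC n C & [set` s] `<=` C) ->
  exists (C : nat -> set X) (n : nat -> nat),
    (forall j, CC (n j) (C j)) /\
    (forall x N, \forall j \near \oo, (N <= n j)%N /\ C j x).
Proof.
move=> FU rCC CCs.
pose h n (C : set X) (x : X) : R :=
  if x \in C then n.+1%:R^-1 else 1 + n.+1%:R^-1.
have q0 : Qp X R (fun=> 0).
  by move=> x U V oU Ux oV V0; exists U; split => //; [exists x|move=> _ [_ _ <-]].
pose toQp f (qf : Qp X R f) : Qp X R :=
  @exist {ptws X -> R} (fun f => f \in Qp X R) f (mem_set qf).
pose f0 := toQp _ q0.
pose A : set (Qp X R) :=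
  [set g | exists p : nat * set X, CC p.1 p.2 /\ set_val g = h p.1 p.2].
have /FU[u Au /Qp_cvgP u0] : closure A f0.
  apply/Qp_closureP => s e e0.
  have [n ne] : exists n, n.+1%:R^-1 < e.
    have [n _ /(_ n (leqnn n)) ?] := near_infty_natSinv_lt (PosNum e0).
    by exists n.
  have [C CCn Cs] := CCs n s.
  have qh : Qp X R (h n C).
    by apply: quasicontinuous_regclosed; exact: rCC CCn.
  exists (toQp _ qh); first by exists (n, C).
  move=> x /Cs Cx; rewrite /f0 /= !set_valE /= /h mem_set//.
  by rewrite sub0r normrN gtr0_norm// invr_gt0.
have [p pP] := choice Au.
exists (fun j => (p j).2), (fun j => (p j).1); split => [j|x N].
  by case: (pP j).
have N0 : 0 < N.+1%:R^-1 :> R by rewrite invr_gt0.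
have /cvgr_dist_lt/(_ _ N0) := u0 x; near_simpl.
apply: filterS => j; rewrite (pP j).2 /f0 set_valE /= sub0r normrN /h.
(* On [C] the bound reads [1/(n+1) < 1/(N+1)], whence [N < n]; off [C] the value exceeds [1], which
   is absurd. *)
case: ifPn => [/set_mem Cx|_].
  rewrite gtr0_norm ?invr_gt0// ltf_pV2 ?posrE// ltr_nat ltnS => /ltnW.
  by split.
have N1 : N.+1%:R^-1 <= 1 :> R by rewrite invf_le1// ler1n.
rewrite gtr0_norm ?addr_gt0 ?invr_gt0// ltNge (le_trans N1)//.
by rewrite lerDl invr_ge0.
Qed.

(** Regular closed sets are stable under finite unions, a union of closures of open sets being the
    closure of their union. *)
Lemma regclosed_seq_cover (X : topologicalType) (s : seq X) (N : X -> set X) :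
  (forall b, b \in s -> exists C, [/\ regclosed C, C b & C `<=` N b]) ->
  exists C, [/\ regclosed C, [set` s] `<=` C &
    C `<=` \bigcup_(b in [set` s]) N b].
Proof.
elim: s => [_|a s IHs sN].
  exists set0; split => //; rewrite -[set0](@closure0 X).
  exact/closure_open_regclosed/open0.
have [|C [rC sC CN]] := IHs.
  by move=> b bs; apply: sN; rewrite inE bs orbT.
have [|D [rD Da DN]] := sN a; first by rewrite mem_head.
exists (D `|` C); split.
- rewrite -[D]rD -[C]rC -closureU.
  by apply: closure_open_regclosed; apply: openU; exact: open_interior.
- by move=> b /=; rewrite inE => /predU1P[->|/sC]; [left|right].
- move=> x [/DN|/CN[b bs Nx]]; first by exists a => //=; exact: mem_head.
  by exists b => //=; rewrite inE (bs : b \in s) orbT.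
Qed.

(** * Thin sets *)

Definition thin (X : topologicalType) (F : set X) :=
  forall b, exists C, [/\ regclosed C, C b & C `&` F `<=` [set b]].

(** By thinness, any finite set lies in a regular closed set with finite trace on [F]; the traces of
    a selected sequence cover [F]. *)
Lemma thin_countable (R : realType) (X : topologicalType) (F : set X) :
  frechet_urysohn (Qp X R) -> thin F -> countable F.
Proof.
move=> FU tF.
have [||C [n [Cfin Cx]]] := @frechet_urysohn_selection R X
    (fun=> [set C | regclosed C /\ finite_set (C `&` F)]) FU.
- by move=> ? ? [].
- move=> _ s; have [b _|C [rC sC CN]] :=
      @regclosed_seq_cover X s (fun b => [set x | F x -> x = b]).
    have [C [rC Cb CF]] := tF b.
    by exists C; split => // x Cx Fx; exact: CF.
  exists C => //; split => //; apply: sub_finite_set (finite_seq s) => x [].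
  by move=> /CN[b /= bs Fxb] /Fxb ->.
- apply: (@sub_countable _ _ _ (\bigcup_j (C j `&` F))).
    apply: subset_card_le => x Fx.
    have [j _ /(_ j (leqnn j))[_ Cjx]] := Cx x 0%N.
    by exists j.
  by apply: bigcup_countable => // j _; apply: finite_set_countable; case: (Cfin j).
Qed.

(** * Thin sets and separated covers in metric spaces *)

Definition metrizes (R : realType) (X : topologicalType) (d : X -> X -> R) :=
  is_metric d /\ forall U : set X, open U <->
    forall x, U x -> exists2 e : R, 0 < e & [set y | d x y < e] `<=` U.

Lemma metrizes_nbhs (R : realType) (X : topologicalType) (d : X -> X -> R)
    (x : X) (U : set X) : metrizes d ->
  nbhs x U <-> exists2 e : R, 0 < e & [set y | d x y < e] `<=` U.
Proof.
move=> [[_ d0 _ dD] oE]; split.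
  rewrite nbhsE => -[V [oV Vx] VU].
  have [e e0 eV] := (oE V).1 oV x Vx.
  by exists e => //; exact: subset_trans VU.
move=> [e e0 eU]; apply: filterS eU _; apply: open_nbhs_nbhs; split; last first.
  by rewrite /= (d0 x x).2.
apply/oE => y /= xy; exists (e - d x y); first by rewrite subr_gt0.
by move=> z /=; rewrite ltrBrDl; apply: le_lt_trans.
Qed.

Lemma metrizes_accessible (R : realType) (X : topologicalType)
    (d : X -> X -> R) : metrizes d -> accessible_space X.
Proof.
move=> md; have [[d_ge0 d0 dC _] _] := md => x y xy; exists [set~ y]; split.
- rewrite openE => z /= zy; apply/(metrizes_nbhs _ _ md).
  exists (d z y) => [|t /= /[swap] ->]; last by rewrite ltxx.
  by rewrite lt0r d_ge0 andbT; apply/eqP => /d0/zy.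
- by rewrite inE; exact/eqP.
- by rewrite setCK inE.
Qed.

Lemma metrizes_regular (R : realType) (X : topologicalType) (d : X -> X -> R)
    (x : X) (U : set X) : metrizes d -> nbhs x U ->
  exists V, [/\ open V, V x & closure V `<=` U].
Proof.
move=> md /(metrizes_nbhs _ _ md)[e e0 eU]; have [[_ _ dC dD] _] := md.
have e20 : 0 < e / 2 by rewrite divr_gt0.
have : nbhs x [set y | d x y < e / 2] by apply/(metrizes_nbhs _ _ md); exists (e / 2).
rewrite nbhsE => -[V [oV Vx] Ve]; exists V; split => // y clVy; apply: eU => /=.
have /clVy[z [/Ve/= xz /= yz]] : nbhs y [set z | d y z < e / 2].
  by apply/(metrizes_nbhs _ _ md); exists (e / 2).
by rewrite [e]splitr (le_lt_trans (dD _ z _))// ltrD// dC.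
Qed.

(* Around [b], small open sets [V n] whose closures avoid [F] are chosen inside
   the balls of radius [1/(n+1)]; their union accumulates on [F] only at [b]. *)
Lemma nowhere_dense_thin (R : realType) (X : topologicalType) (d : X -> X -> R)
    (F : set X) : metrizes d -> closed F -> dense (~` F) -> thin F.
Proof.
move=> md cF dF b; have [[_ d0 _ _] _] := md.
have /choice[V VP] n : exists V : set X, [/\ open V, V !=set0,
    V `<=` [set y | d b y < n.+1%:R^-1] & closure V `<=` ~` F].
  have nb : nbhs b [set y | d b y < n.+1%:R^-1].
    by apply/(metrizes_nbhs _ _ md); exists n.+1%:R^-1; rewrite ?invr_gt0.
  have [|z [Bz Fz]] := dF _ _ (open_interior [set y | d b y < n.+1%:R^-1]).
    by exists b.
  have [|W [oW Wz WF]] := metrizes_regular (x := z)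
    (U := [set y | d b y < n.+1%:R^-1]° `&` ~` F) md.
    apply: open_nbhs_nbhs; split => //; apply: openI; first exact: open_interior.
    exact: closed_openC.
  exists W; split => //; first by exists z.
    by move=> t /subset_closure/WF[/interior_subset].
  by move=> t /WF[].
exists (closure (\bigcup_n V n)); split.
- by apply/closure_open_regclosed/bigcup_open => n _; case: (VP n).
- move=> U /(metrizes_nbhs _ _ md)[e e0 eU].
  have [n _ /(_ n (leqnn n)) ne] := near_infty_natSinv_lt (PosNum e0).
  have [_ [z Vz] VB _] := VP n; exists z; split; first by exists n.
  by apply: eU => /=; apply: lt_trans (VB z Vz) ne.
(* If [y] differs from [b], some neighbourhood of [y] misses almost all [V i], which shrink to [b],
   and also the finitely many others, whose closures avoid [F]. *)
- move=> y [clVy Fy]; apply: contrapT => /eqP yb.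
  have [|W [oW Wb Wy]] := metrizes_regular (x := b) (U := [set~ y]) md.
    apply: open_nbhs_nbhs; split; last by move=> /= /esym/eqP; apply/negP.
    rewrite openC; apply: accessible_closed_set1; exact: metrizes_accessible md.
  have [e e0 eW] := (metrizes_nbhs _ _ md).1 (open_nbhs_nbhs (conj oW Wb)).
  have [k _ ke] := near_infty_natSinv_lt (PosNum e0).
  have nW : nbhs y (~` closure W).
    apply: open_nbhs_nbhs; split; last by move=> /Wy; apply.
    exact/closed_openC/closed_closure.
  have nV : \forall z \near y, forall i : 'I_k, ~ closure (V i) z.
    apply: filter_forall => i; apply: open_nbhs_nbhs; split.
      exact/closed_openC/closed_closure.
    by move=> Vy; have [_ _ _ /(_ _ Vy)] := VP i.
  have [z [[i _ Viz] [Wz Vz]]] := clVy _ (filterI nW nV).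
  have [ik|ki] := ltnP i k.
    by apply: (Vz (Ordinal ik)); exact: subset_closure.
  apply: Wz; apply: subset_closure; apply: eW => /=.
  have [_ _ /(_ z Viz)/= bz _] := VP i.
  exact: lt_trans bz (ke i ki).
Qed.

(** The uniform radius makes the set clopen, so either the open singleton of [b] or the complement
    of the set serves. *)
Lemma isolated_thin (R : realType) (X : topologicalType) (d : X -> X -> R)
    (e : R) : metrizes d -> 0 < e ->
  thin [set x | forall y, d x y < e -> y = x].
Proof.
move=> md e0 b; have [[_ _ dC _] _] := md; set F := [set x | _].
have oF : open F.
  rewrite openE => x Fx; apply/(metrizes_nbhs _ _ md); exists e => //.
  by move=> y /Fx ->.
have cF : closed F.
  move=> y clFy; have [|x [Fx /= yx]] := clFy [set z | d y z < e].
    by apply/(metrizes_nbhs _ _ md); exists e.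
  by rewrite (Fx y)// dC.
have [Fb|Fb] := pselect (F b).
- exists (closure [set b]); split.
  + apply: closure_open_regclosed; rewrite openE => _ ->.
    by apply/(metrizes_nbhs _ _ md); exists e.
  + exact: subset_closure.
  + move=> x [clx _]; apply: (_ : closed [set b]) => //.
    by apply: accessible_closed_set1; exact: metrizes_accessible md.
- exists (closure (~` F)); split.
  + exact/closure_open_regclosed/closed_openC.
  + exact: subset_closure.
  + by move=> x [+ Fx]; rewrite closure_setC (interior_id _).1// => /(_ Fx).
Qed.

(** Each non-isolated [b] in [s] gets a companion [y b] outside [s] within [e/2]. Covering [s] by
    sets of radius [e/2] that avoid all companions leaves one within [e] of each non-isolated point
    covered. *)
Lemma finite_separated_cover (R : realType) (X : topologicalType)
    (d : X -> X -> R) (e : R) (s : seq X) : metrizes d -> 0 < e ->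
  exists C, [/\ regclosed C, [set` s] `<=` C &
    forall x : X, ~ nbhs x [set x] -> exists2 y, ~ C y & d x y < e].
Proof.
move=> md e0; have [[_ d0 dC dD] _] := md.
have cfin := accessible_finite_set_closed.1 (metrizes_accessible md).
have e20 : 0 < e / 2 by rewrite divr_gt0.
have ball b : nbhs b [set y | d b y < e / 2].
  by apply/(metrizes_nbhs _ _ md); exists (e / 2).
have /choice[y yP] (b : X) : exists y, ~ nbhs b [set b] -> y \notin s /\ d b y < e / 2.
  have [|nb] := pselect (nbhs b [set b]); first by exists b.
  have [[y [ys dby]]|sy] := pselect (exists y, y \notin s /\ d b y < e / 2).
    by exists y.
  (* Otherwise the ball lies in the finite set [s], and removing the other points of [s] isolates
     [b]. *)
  exfalso; apply: nb.
  have ns : nbhs b (~` [set` [seq c <- s | c != b]]).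
    apply: open_nbhs_nbhs; split; last by rewrite /= mem_filter /= eqxx.
    by apply: closed_openC; apply: cfin; exact: finite_seq.
  apply: filterS (filterI (ball b) ns) => z [bz /= zs].
  apply: contrapT => /eqP zb; apply: sy; exists z; split => //.
  by apply/negP => sz; apply: zs; rewrite mem_filter /= zb.
pose P (c : X) := `[< ~ nbhs c [set c] >].
pose Y : set X := [set` [seq y b | b <- s & P b]].
(* The middle clause shrinks [N b] to [b] when [b] is isolated, so a non-isolated point of the cover
   is near a [b] that has a companion. *)
pose N (b : X) := [set z | [/\ d b z < e / 2, nbhs b [set b] -> z = b & ~ Y z]].
have [b bs|C [rC sC CN]] := @regclosed_seq_cover X s N.
  have [|V [oV Vb VN]] := metrizes_regular (x := b) (U := N b) md.
    have nY : nbhs b (~` Y).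
      apply: open_nbhs_nbhs; split.
        by apply: closed_openC; apply: cfin; exact: finite_seq.
      move=> /= /mapP[a]; rewrite mem_filter => /andP[/asboolP/yP[ya _] _] ba.
      by move: ya; rewrite -ba bs.
    apply: filterS3 (ball b) nY (_ : nbhs b [set z | nbhs b [set b] -> z = b]).
      by move=> z.
    have [nb|nb] := pselect (nbhs b [set b]); first by apply: filterS nb => ? ->.
    by apply: nearW => z /nb.
  exists (closure V); split => //; first exact: closure_open_regclosed.
  exact: subset_closure.
exists C; split => // x nx.
have [Cx|Cx] := pselect (C x); last by exists x => //; rewrite (d0 x x).2.
have [b /= bs [bx bI _]] := CN x Cx.
have nb : ~ nbhs b [set b] by move=> nb; apply: nx; rewrite (bI nb).
exists (y b).
  move=> /CN[c _ [_ _]]; apply => /=; apply: map_f.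
  by rewrite mem_filter bs andbT; apply/asboolP.
rewrite [e]splitr (le_lt_trans (dD _ b _))// ltrD//; first by rewrite dC.
by have [] := yP b nb.
Qed.

(** * Countability of the space *)

Lemma frechet_urysohn_countable (R : realType) (X : topologicalType)
    (d : X -> X -> R) : metrizes d ->
  frechet_urysohn (Qp X R) -> countable [set: X].
Proof.
move=> md FU; have [[_ d0 _ _] _] := md.
(* The isolated points, sorted by a radius of isolation so that each piece is thin. *)
pose I := \bigcup_n [set x | forall y, d x y < n.+1%:R^-1 -> y = x].
have cI : countable I.
  apply: bigcup_countable => // n _; apply: (thin_countable FU).
  by apply: isolated_thin md _; rewrite invr_gt0.
have IE : I = [set x : X | nbhs x [set x]].
  apply/seteqP; split => x.
    move=> [n _ nx]; apply/(metrizes_nbhs _ _ md).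
    by exists n.+1%:R^-1 => //; rewrite invr_gt0.
  move=> /(metrizes_nbhs _ _ md)[e e0 ex].
  have [n _ /(_ n (leqnn n)) ne] := near_infty_natSinv_lt (PosNum e0).
  by exists n => // y xy; apply: ex; exact: lt_trans ne.
have oI : open I.
  rewrite IE openE => x /= nx; apply: filterS (nx) => _ ->; exact: nx.
have [||C [n [Cn Cx]]] := @frechet_urysohn_selection R X (fun n C => regclosed C /\
    forall x, ~ I x -> exists2 y, ~ C y & d x y < n.+1%:R^-1) FU.
- by move=> ? ? [].
- move=> n s; have [|C [rC sC CP]] := finite_separated_cover (e := n.+1%:R^-1) s md.
    by rewrite invr_gt0.
  by exists C => //; split => //; rewrite IE.
pose K m := (\bigcap_(j in [set j | (m <= j)%N]) C j) `&` ~` I.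
suff cK m : countable (K m).
  apply: (@sub_countable _ _ _ (I `|` \bigcup_m K m)).
    apply: subset_card_le => x _; have [Ix|Ix] := pselect (I x); [by left|right].
    have [m _ mC] := Cx x 0%N; exists m => //; split => // j /= mj.
    by have [] := mC j mj.
  rewrite -bigcup2E; apply: bigcup_countable => // -[|[|i]] _ //=.
    exact: bigcup_countable.
apply: (thin_countable FU); apply: (nowhere_dense_thin md).
  apply: closedI; last by rewrite closedC.
  by apply: closed_bigI => j _; have [<- _] := Cn j; exact: closed_closure.
move=> U [x Ux] oU; have [e e0 eU] := (metrizes_nbhs _ _ md).1 (open_nbhs_nbhs (conj oU Ux)).
have [Ix|Ix] := pselect (I x); first by exists x; split => // -[].
have [k _ ke] := near_infty_natSinv_lt (PosNum e0).
(* [i >= j] puts the complement of [C i] within [e] of [x]; [i >= m] makes a point off [C i] lie off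
   [K m]. *)
have [j _ jP] := Cx x k; pose i := maxn m j.
have [ki _] := jP i (leq_maxr _ _).
have [_ /(_ x Ix)[y Cy xy]] := Cn i.
exists y; split; first by apply: eU => /=; exact: lt_trans xy (ke _ ki).
by move=> [/(_ i (leq_maxl _ _))].
Qed.

Theorem theorem3p11 (R : realType) (X : topologicalType) (mX : metrizable R X) :
  frechet_urysohn (Qp X R) <-> countable [set: X].
Proof.
split; last exact: countable_frechet_urysohn.
have [d md dX] := mX.
exact: (@frechet_urysohn_countable R X d (conj md dX)).
Qed.
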